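(* For all integers $n\ge 1$ and $s\ge1$, the Lah polynomials of order $s$ satisfy the recurrence relation $$\mathcal{L}_{n+1}^{s}(x)=x\,\mathcal{L}_{n}^{s}(x)+n^s\,\mathcal{L}_{n}^{s}(x)+B_n^s(x),$$ where, for $n\ge1$, $s\ge1$, $$B_n^s(x)=\sum_{k=0}^{n}k^s\left\lceil\!\!\left\lceil\begin{matrix} n\\ k\end{matrix}\right\rceil\!\!\right\rceil_{s}x^k.$$
   Context: For a partition $\pi=\{b_1,\dots,b_k\}$ of $[n]=\{1,\dots,n\}$ into non-empty blocks, $\operatorname{bl}\pi=\{\min b_1,\dots,\min b_k\}$. For $s\ge1$, the Stirling number of the first kind with higher level, $\left[\!\left[\begin{matrix} n\\ k\end{matrix}\right]\!\right]_{s}$ (resp. of the second kind, $\left\{\!\left\{\begin{matrix} n\\ k\end{matrix}\right\}\!\right\}_{s}$), is the number of ordered $s$-tuples $(\pi_1,\dots,\pi_s)$ of partitions of $[n]$ into $k$ non-empty cyclically ordered blocks (resp. $k$ non-empty unordered blocks) with $\operatorname{bl}\pi_1=\dots=\operatorname{bl}\pi_s$. Equivalently (known), they are determined for $n,k\ge1$ by $\left[\!\left[\begin{matrix} n\\ k\end{matrix}\right]\!\right]_{s}=\left[\!\left[\begin{matrix} n-1\\ k-1\end{matrix}\right]\!\right]_{s}+(n-1)^s\left[\!\left[\begin{matrix} n-1\\ k\end{matrix}\right]\!\right]_{s}$ and $\left\{\!\left\{\begin{matrix} n\\ k\end{matrix}\right\}\!\right\}_{s}=\left\{\!\left\{\begin{matrix}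 n-1\\ k-1\end{matrix}\right\}\!\right\}_{s}+k^s\left\{\!\left\{\begin{matrix} n-1\\ k\end{matrix}\right\}\!\right\}_{s}$, both being $1$ at $(n,k)=(0,0)$ and $0$ at $(n,0)$ and $(0,n)$ for $n>0$. The Lah numbers of order $s$ are defined for integers $n,k\ge0$, $s\ge1$ by $$\left\lceil\!\!\left\lceil\begin{matrix} n\\ k\end{matrix}\right\rceil\!\!\right\rceil_{s}=\sum_{j=k}^{n}\left[\!\left[\begin{matrix} n\\ j\end{matrix}\right]\!\right]_{s}\left\{\!\left\{\begin{matrix} j\\ k\end{matrix}\right\}\!\right\}_{s},$$ and are $0$ for $n<k$. For $n\ge1$, $s\ge1$ the Lah polynomials of order $s$ are $\mathcal{L}_n^s(x)=\sum_{k=0}^{n}\left\lceil\!\!\left\lceil\begin{matrix} n\\ k\end{matrix}\right\rceil\!\!\right\rceil_{s}x^k$. *)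

(* Defs.v *)
From mathcomp Require Import all_boot all_order all_fingroup all_algebra.

Set Implicit Arguments.
Unset Strict Implicit.
Unset Printing Implicit Defensive.

Import GRing.Theory.

(* The ground set [n] = {1, ..., n} is represented by 'I_n = {0, ..., n-1}. *)

Definition bl (n : nat) (P : {set {set 'I_n}}) : {set 'I_n} :=
  [set i : 'I_n | [exists b in P, (i \in b) && [forall j in b, i <= j]]].

Definition kblocks (n k : nat) (P : {set {set 'I_n}}) : bool :=
  partition P [set: 'I_n] && (#|P| == k).

(* A cyclic order on a finite block is given by its successor map, which is a
   permutation of the block with a single orbit.  Hence cyclic orders on all
   the blocks of P amount to one permutation c of 'I_n whose orbit at each
   point is the block containing that point. *)
Definition cyc_kblocks (n k : nat) (p : {set {set 'I_n}} * {perm 'I_n}) : bool :=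
  kblocks k p.1 && [forall b in p.1, forall x in b, porbit p.2 x == b].

Definition stirling1 (s n k : nat) : nat :=
  #|[set t : s.-tuple ({set {set 'I_n}} * {perm 'I_n}) |
      [forall i : 'I_s, cyc_kblocks k (tnth t i)] &&
      [forall i : 'I_s, forall j : 'I_s,
         bl (tnth t i).1 == bl (tnth t j).1]]|.

Definition stirling2 (s n k : nat) : nat :=
  #|[set t : s.-tuple {set {set 'I_n}} |
      [forall i : 'I_s, kblocks k (tnth t i)] &&
      [forall i : 'I_s, forall j : 'I_s, bl (tnth t i) == bl (tnth t j)]]|.

(* For n < k the range is empty and the value is 0. *)
Definition lah (s n k : nat) : nat :=
  \sum_(k <= j < n.+1) stirling1 s n j * stirling2 s j k.

Local Open Scope ring_scope.

Definition lah_poly (s n : nat) : {poly int} :=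
  \sum_(k < n.+1) (lah s n k)%:R *: 'X^k.

Definition lah_B (s n : nat) : {poly int} :=
  \sum_(k < n.+1) (k ^ s * lah s n k)%N%:R *: 'X^k.

(* Main.v *)
Require Import Defs.
From mathcomp Require Import all_boot all_order all_fingroup all_algebra.

Set Implicit Arguments.
Unset Strict Implicit.
Unset Printing Implicit Defensive.

Import GRing.Theory.

(** The coefficient form of the theorem is the triangular recurrence
    [L(n+1,k) = L(n,k-1) + (n^s + k^s) L(n,k)] for the Lah numbers of order [s]
    ([lah_recr]).  It follows from the recurrences
    [c(n+1,k+1) = c(n,k) + n^s c(n,k+1)] and [S(n+1,k) = S(n,k-1) + k^s S(n,k)]
    of the two kinds of Stirling numbers: expand [c(n+1,j)] in the defining sum
    of [L(n+1,k)], shift the index [j], and expand the [S(j+1,k)] that the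
    first term leaves behind.

    For the Stirling recurrences, sort the tuples by the common set [B] of
    block minima.  Once [B] is chosen, the [s] components are independent, so
    each Stirling number is the sum over [k]-element sets [B] of the [s]-th
    power of the number of single structures with minima [B]
    ([stirling1E], [stirling2E]).  It remains to see what happens to these
    single counts when a new largest point is added to the ground set.  If the
    new point belongs to the set of minima, it is alone in its block and the
    count is unchanged.  Otherwise it joins an existing block, which can be
    done in [#|B|] ways for a partition and in [n] ways for a permutation
    (it is inserted into a cycle just before any of the [n] old points).

    For partitions these factors are read off a product formula: a partition
    is the same thing as the map sending each point to the minimum of its
    block, and that map is chosen freely among the smaller elements of [B] at
    each point outside [B] ([num_partitionsE]).  For permutations an explicit
    bijection inserts the new point into a cycle ([insert_max_bij],
    [bl_insert_max]). *)

(** * Tuples with a common statistic *)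


(** Given the common value of [f], the components of the tuple are chosen
    independently.  For [s = 0] the empty tuple would be counted once for each
    value. *)
Lemma card_agreeing_tuples {T U : finType} (A : pred T) (f : T -> U) s :
  0 < s ->
  #|[set t : s.-tuple T | [forall i : 'I_s, A (tnth t i)] &&
       [forall i : 'I_s, forall j : 'I_s, f (tnth t i) == f (tnth t j)]]|
  = \sum_u #|[set x | A x && (f x == u)]| ^ s.
Proof.
case: s => // s _.
rewrite -sum1_card (partition_big (fun t => f (tnth t ord0)) xpredT) //=.
apply: eq_bigr => u _; rewrite sum1dep_card.
rewrite -[s.+1 in RHS]card_ord -card_ffun_on.
rewrite -(card_image (f := tuple_of_finfun) (can_inj tuple_of_finfunK)).
apply: eq_card => t; rewrite inE /= [in LHS]inE.
apply/andP/imageP => [[/andP[/forallP At /forallP ft] /eqP t0]|[g /ffun_onP gP ->]].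
- exists (finfun_of_tuple t); last by rewrite finfun_of_tupleK.
  apply/ffun_onP => i; rewrite ffunE inE At -t0 /=.
  exact: (forallP (ft i) ord0).
- have gE i : tnth (tuple_of_finfun g) i = g i.
    by rewrite -{2}(tuple_of_finfunK g) ffunE.
  have {}gP i : A (g i) /\ f (g i) = u.
    by move: (gP i); rewrite inE => /andP[? /eqP].
  rewrite gE (gP ord0).2 eqxx; split=> //; apply/andP; split.
    by apply/forallP => i; rewrite gE (gP i).1.
  by apply/forallP => i; apply/forallP => j; rewrite !gE !(gP _).2.
Qed.

(** * Orbits of a permutation *)

Lemma porbit_step (T : finType) (s : {perm T}) (x y : T) :
  x \in porbit s y -> s x \in porbit s y.
Proof.
case/porbitP => k ->; apply/porbitP; exists k.+1.
by rewrite expgSr permM.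
Qed.

Lemma porbit_ind (T : finType) (s : {perm T}) (Q : T -> Prop) (x : T) :
  Q x -> (forall y, Q y -> Q (s y)) -> forall y, y \in porbit s x -> Q y.
Proof.
move=> Qx Qs y /porbitP[k ->]; elim: k => [|k IHk]; first by rewrite expg0 perm1.
by rewrite expgSr permM; apply: Qs.
Qed.

(** * Partitions and permutations with given block minima *)

Section BlockMinima.

Context {n : nat}.
Implicit Types (P : {set {set 'I_n}}) (B : {set 'I_n}) (i j : 'I_n).

(** Being the minimum of some block is a property of the block through [i];
    this removes the quantifier over blocks in the definition of [bl]. *)
Lemma mem_bl P i : partition P [set: 'I_n] ->
  (i \in bl P) = [forall j in pblock P i, i <= j].
Proof.
move=> Ppart; have [/eqP covP tiP _] := and3P Ppart.
have iP : i \in cover P by rewrite covP inE.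
rewrite inE; apply/existsP/idP => [[b /and3P[bP ib min_i]]|min_i].
  by rewrite (def_pblock tiP bP ib).
by exists (pblock P i); rewrite pblock_mem // mem_pblock iP.
Qed.

Lemma ord_min_exists B i : i \in B ->
  exists2 m, m \in B & forall j, j \in B -> m <= j.
Proof. by move=> iB; case: (arg_minnP val iB) => m mB min_m; exists m. Qed.

(** A block is determined by its minimum, so counting blocks is counting
    minima: the number [k] of blocks is a function of the set of minima. *)
Lemma card_bl P : partition P [set: 'I_n] -> #|bl P| = #|P|.
Proof.
move=> Ppart; have [/eqP covP tiP P0] := and3P Ppart.
have inP i : i \in cover P by rewrite covP inE.
have pb_inj : {in bl P &, injective (pblock P)}.
  move=> i j; rewrite !mem_bl // => /forall_inP min_i /forall_inP min_j eq_ij.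
  apply/val_inj/anti_leq; apply/andP; split.
    by apply: min_i; rewrite eq_ij mem_pblock.
  by apply: min_j; rewrite -eq_ij mem_pblock.
rewrite -(card_in_imset pb_inj); apply: eq_card => b.
apply/imsetP/idP => [[i _ ->]|bP]; first exact: pblock_mem.
have /set0Pn[i0 i0b] : b != set0 by apply: contraNneq P0 => <-.
have [m mb min_m] := ord_min_exists i0b.
exists m; last by rewrite (def_pblock tiP bP mb).
by rewrite mem_bl // (def_pblock tiP bP mb); apply/forall_inP.
Qed.

Lemma mem_pblock_preim (T : eqType) (m : 'I_n -> T) i j :
  (j \in pblock (preim_partition m [set: 'I_n]) i) = (m i == m j).
Proof.
rewrite pblock_equivalence_partition ?inE //.
by split=> // /eqP ->.
Qed.

Lemma partition_eq_pblock P Q : partition P [set: 'I_n] ->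
  partition Q [set: 'I_n] ->
  (forall i j, (j \in pblock P i) = (j \in pblock Q i)) -> P = Q.
Proof.
move=> Pp Qp eqPQ.
rewrite -(equivalence_partition_pblock Pp) -(equivalence_partition_pblock Qp).
by apply: eq_in_imset => i _; apply/setP=> j; rewrite !inE /= eqPQ.
Qed.

Definition num_partitions B : nat :=
  #|[set P | partition P [set: 'I_n] && (bl P == B)]|.

(** A partition corresponds to the map [m] sending each point to the minimum of
    its block.  The maps that arise for minima [B] are those that fix [B]
    pointwise and send each [i] outside [B] to a smaller element of [B]; these
    choices are independent, whence the product. *)
Lemma num_partitionsE B :
  num_partitions B = \prod_(i | i \notin B) #|[set b in B | b < i]|.
Proof.
pose F i := if i \in B then [set i] else [set b in B | b < i].
have FP (m : {ffun 'I_n -> 'I_n}) :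
    reflect (forall i, [/\ m i \in B, m i <= i & i \in B -> m i = i])
            (m \in family F).
  apply: (iffP familyP) => mP i; have := mP i; rewrite /F.
    case: ifPn => iB; first by move/set1P->.
    by rewrite inE => /andP[miB /ltnW le_mi]; split=> // iB'; rewrite iB' in iB.
  case: ifPn => iB; first by case=> _ _ ->; rewrite ?set11.
  case=> miB le_mi _; rewrite inE miB ltn_neqAle le_mi andbT.
  by apply: contraNneq iB => /val_inj <-.
have -> : \prod_(i | i \notin B) #|[set b in B | b < i]| = #|family F|.
  rewrite card_family foldrE big_image /= big_mkcond /=.
  apply: eq_bigr => i _; rewrite /F; case: ifPn; first by move/negbTE->.
  by rewrite negbK => ->; rewrite cards1.
pose h (m : {ffun 'I_n -> 'I_n}) := preim_partition m [set: 'I_n].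
(* [m i] is the least element of the fibre of [m] through [i], so the fibres
   determine [m]. *)
have h_inj : {in family F &, injective h}.
  move=> m1 m2 /FP m1P /FP m2P eq_h; apply/ffunP => i.
  have eq_ker j k : (m1 j == m1 k) = (m2 j == m2 k).
    by rewrite -!mem_pblock_preim -/(h m1) eq_h.
  have [m1B _ _] := m1P i; have [m2B _ _] := m2P i.
  have [_ _ /(_ m1B) m1K] := m1P (m1 i); have [_ _ /(_ m2B) m2K] := m2P (m2 i).
  have /eqP e1 : m1 (m2 i) == m1 i by rewrite eq_ker m2K.
  have /eqP e2 : m2 (m1 i) == m2 i by rewrite -eq_ker m1K.
  have [_ le1 _] := m1P (m2 i); have [_ le2 _] := m2P (m1 i).
  by apply/val_inj/anti_leq; move: le1 le2; rewrite e1 e2 => -> ->.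
rewrite -(card_in_imset h_inj); apply: eq_card => P; rewrite inE.
apply/andP/imsetP => [[Pp /eqP blP]|[m /FP mP ->]]; last first.
  have hp := preim_partitionP m [set: 'I_n]; split=> //.
  apply/eqP/setP => i; rewrite mem_bl //.
  have [miB le_mi miE] := mP i; have [_ _ /(_ miB) mK] := mP (m i).
  apply/forall_inP/idP => [min_i|iB j].
    suff -> : i = m i by [].
    by apply/val_inj/anti_leq; rewrite le_mi min_i // mem_pblock_preim mK.
  rewrite mem_pblock_preim miE // => /eqP ->.
  by have [_ ->] := mP j.
have [/eqP covP tiP P0] := and3P Pp.
have inP i : i \in cover P by rewrite covP inE.
have mP i : exists m, (m \in pblock P i) && [forall j in pblock P i, m <= j].
  have ii : i \in pblock P i by rewrite mem_pblock.
  have [m mi min_m] := ord_min_exists ii.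
  by exists m; rewrite mi; apply/forall_inP.
pose m := [ffun i => xchoose (mP i)].
have mi i : m i \in pblock P i.
  by rewrite ffunE; case/andP: (xchooseP (mP i)).
have min_m i j : j \in pblock P i -> m i <= j.
  by rewrite ffunE; case/andP: (xchooseP (mP i)) => _ /forall_inP; apply.
have pbm i : pblock P (m i) = pblock P i by apply/esym/eqP; rewrite eq_pblock.
exists m.
  apply/FP => i; split; last 1 first.
  - rewrite -blP mem_bl // => /forall_inP min_i.
    by apply/val_inj/anti_leq; rewrite min_m ?min_i // mem_pblock.
  - by rewrite -blP mem_bl //; apply/forall_inP => j; rewrite pbm; apply: min_m.
  - by rewrite min_m // mem_pblock.
apply: partition_eq_pblock => // [|i j]; first exact: preim_partitionP.
rewrite mem_pblock_preim -eq_pblock //; apply/eqP/eqP => [eq_ij|eq_m].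
  by apply/val_inj/anti_leq; rewrite !min_m // ?eq_ij // -eq_ij.
by rewrite -pbm eq_m pbm.
Qed.

Implicit Type c : 'S_n.

Lemma partition_porbits c : partition (porbits c) [set: 'I_n].
Proof.
apply/and3P; split.
- apply/eqP/setP => x; rewrite inE; apply/bigcupP; exists (porbit c x).
    exact: imset_f.
  exact: porbit_id.
- apply/trivIsetP => _ _ /imsetP[x _ ->] /imsetP[y _ ->] neq.
  apply/pred0P => z /=; apply: contraNF neq => /andP[].
  by rewrite -!eq_porbit_mem => /eqP-> /eqP->.
- by apply/imsetP => -[x _ x0]; have := porbit_id c x; rewrite -x0 inE.
Qed.

Lemma pblock_porbits c i : pblock (porbits c) i = porbit c i.
Proof.
have /and3P[_ ti _] := partition_porbits c.
by apply: def_pblock => //; [exact: imset_f | exact: porbit_id].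
Qed.

Lemma mem_bl_porbits c i :
  (i \in bl (porbits c)) = [forall j in porbit c i, i <= j].
Proof. by rewrite mem_bl ?partition_porbits // pblock_porbits. Qed.

(** The orbit condition forces the partition to be that of the cycles, so a
    partition with cyclically ordered blocks is just a permutation. *)
Lemma cyc_kblocksE k (p : {set {set 'I_n}} * 'S_n) :
  cyc_kblocks k p = kblocks k p.1 && (p.1 == porbits p.2).
Proof.
rewrite /cyc_kblocks; case kP: (kblocks k p.1) => //=.
have /andP[Pp _] := kP; have [/eqP covP tiP _] := and3P Pp.
have inP i : i \in cover p.1 by rewrite covP inE.
apply/forall_inP/eqP => [orbP|-> b].
  apply: partition_eq_pblock => // [|i j]; first exact: partition_porbits.
  have iP := pblock_mem (inP i).
  have /forall_inP/(_ i) := orbP _ iP; rewrite mem_pblock => /(_ (inP i))/eqP <-.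
  by rewrite pblock_porbits.
case/imsetP => x _ ->; apply/forall_inP => y.
by rewrite -eq_porbit_mem.
Qed.

Definition num_perms B : nat := #|[set c : 'S_n | bl (porbits c) == B]|.

End BlockMinima.

(** * Stirling numbers as sums over the common set of minima *)

(** Sets [B] with [#|B| <> k] contribute the [s]-th power of an empty count,
    which vanishes because [s] is positive. *)
Lemma stirling2E s n k : 0 < s ->
  stirling2 s n k = \sum_(B : {set 'I_n} | #|B| == k) num_partitions B ^ s.
Proof.
move=> s_gt0; rewrite /stirling2 card_agreeing_tuples // [RHS]big_mkcond /=.
apply: eq_bigr => B _; case: ifPn => Bk.
  congr (_ ^ _); apply: eq_card => P; rewrite !inE /kblocks.
  case Pp: (partition P _) => //=.
  case: (eqVneq (bl P) B) => blP; last by rewrite andbF.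
  by rewrite -card_bl // blP Bk.
rewrite (_ : [set _ | _] = set0) ?cards0 ?exp0n //.
apply/setP => P; rewrite !inE; apply/negbTE; apply: contra Bk.
by case/andP => /andP[/card_bl <- /eqP <-] /eqP ->.
Qed.

Lemma stirling1E s n k : 0 < s ->
  stirling1 s n k = \sum_(B : {set 'I_n} | #|B| == k) num_perms B ^ s.
Proof.
move=> s_gt0; rewrite /stirling1.
rewrite (card_agreeing_tuples _ (fun p => bl p.1)) // [RHS]big_mkcond /=.
apply: eq_bigr => B _; case: ifPn => Bk.
  congr (_ ^ _).
  have inj_g : injective (fun c : 'S_n => (porbits c, c)) by move=> c d [].
  rewrite /num_perms -(card_imset _ inj_g); apply: eq_card => -[P c].
  rewrite inE cyc_kblocksE /=; apply/andP/imsetP => [[/andP[_ /eqP->] blB]|].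
    by exists c; rewrite ?inE.
  case=> d; rewrite inE => blB [-> ->]; rewrite blB eqxx andbT; split=> //.
  by rewrite /kblocks partition_porbits -card_bl ?partition_porbits // (eqP blB).
rewrite (_ : [set _ | _] = set0) ?cards0 ?exp0n //.
apply/setP => p; rewrite !inE; apply/negbTE; apply: contra Bk.
by case/andP => /andP[/andP[/card_bl <- /eqP <-] _] /eqP ->.
Qed.

(** * Adding a new largest point *)

Section AddLargest.

Context {n : nat}.
Implicit Types (B C : {set 'I_n}) (c : 'S_n) (i : 'I_n.+1).

Definition embed B : {set 'I_n.+1} := [set lift ord_max x | x in B].
Definition with_max B : {set 'I_n.+1} := ord_max |: embed B.

Lemma lift_max_neq (x : 'I_n) : (lift ord_max x == ord_max) = false.
Proof. by apply/negbTE; rewrite eq_sym neq_lift. Qed.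

Lemma mem_embed B x : (lift ord_max x \in embed B) = (x \in B).
Proof. by rewrite mem_imset //; apply: lift_inj. Qed.

Lemma max_notin_embed B : ord_max \in embed B = false.
Proof.
by apply/negP => /imsetP[x _ /eqP]; rewrite eq_sym lift_max_neq.
Qed.

Lemma mem_with_max B x : (lift ord_max x \in with_max B) = (x \in B).
Proof. by rewrite in_setU1 lift_max_neq mem_embed. Qed.

Lemma max_in_with_max B : ord_max \in with_max B.
Proof. exact: setU11. Qed.

Lemma card_embed B : #|embed B| = #|B|.
Proof. by rewrite card_imset //; apply: lift_inj. Qed.

Lemma card_with_max B : #|with_max B| = #|B|.+1.
Proof. by rewrite cardsU1 max_notin_embed card_embed. Qed.

Lemma setP_max (C D : {set 'I_n.+1}) : (ord_max \in C) = (ord_max \in D) ->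
  (forall x : 'I_n, (lift ord_max x \in C) = (lift ord_max x \in D)) -> C = D.
Proof. by move=> eqm eql; apply/setP => i; case: (unliftP ord_max i) => [x|] ->. Qed.

Lemma big_set_recr (p : pred nat) (F : {set 'I_n.+1} -> nat) :
  \sum_(C : {set 'I_n.+1} | p #|C|) F C =
  \sum_(B : {set 'I_n} | p #|B|.+1) F (with_max B) +
  \sum_(B : {set 'I_n} | p #|B|) F (embed B).
Proof.
pose trace (C : {set 'I_n.+1}) := [set x | lift ord_max x \in C].
rewrite (bigID (fun C : {set 'I_n.+1} => ord_max \in C)) /=; congr (_ + _).
  rewrite (reindex_onto with_max trace) /=.
    apply: eq_bigl => B; rewrite card_with_max max_in_with_max andbT.
    by rewrite (_ : trace _ = B) ?eqxx ?andbT //;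
       apply/setP => x; rewrite inE mem_with_max.
  move=> C /andP[_ mC]; apply: setP_max => [|x]; first by rewrite max_in_with_max mC.
  by rewrite mem_with_max inE.
rewrite (reindex_onto embed trace) /=.
  apply: eq_bigl => B; rewrite card_embed max_notin_embed andbT.
  by rewrite (_ : trace _ = B) ?eqxx ?andbT //;
     apply/setP => x; rewrite inE mem_embed.
move=> C /andP[_ mC]; apply: setP_max => [|x].
  by rewrite max_notin_embed (negbTE mC).
by rewrite mem_embed inE.
Qed.

Lemma below_lift (C : {set 'I_n.+1}) B (x : 'I_n) :
  (forall y : 'I_n, (lift ord_max y \in C) = (y \in B)) ->
  #|[set b in C | b < lift ord_max x]| = #|[set b in B | b < x]|.
Proof.
move=> eqC; rewrite -[RHS]card_embed; apply: eq_card => i.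
case: (unliftP ord_max i) => [y|] ->; last first.
  by rewrite max_notin_embed inE lift_max /= ltnNge ltnW ?andbF.
by rewrite mem_embed !inE eqC !lift_max.
Qed.

Lemma below_max B : [set b in embed B | b < @ord_max n] = embed B.
Proof.
apply/setP => i; rewrite inE.
case: (unliftP ord_max i) => [y|] ->; last by rewrite max_notin_embed.
by rewrite lift_max ltn_ord andbT.
Qed.

Lemma prod_lift (C : {set 'I_n.+1}) (w : 'I_n.+1 -> nat) :
  \prod_(i | i \notin C) w i =
  (if ord_max \in C then 1 else w ord_max) *
  \prod_(x : 'I_n | lift ord_max x \notin C) w (lift ord_max x).
Proof.
rewrite big_mkcond big_ord_recr /= mulnC.
rewrite if_neg; congr (_ * _); rewrite [RHS]big_mkcond.
by apply: eq_bigr => x _; rewrite (_ : widen_ord _ x = lift ord_max x) //;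
   apply/val_inj/esym/lift_max.
Qed.

(** The product formula compares the two ground sets factor by factor: the
    factors at old points agree, because the new point lies below none of
    them. *)
Lemma num_partitions_with_max B :
  num_partitions (with_max B) = num_partitions B.
Proof.
rewrite !num_partitionsE prod_lift max_in_with_max mul1n.
apply: eq_big => x; first by rewrite mem_with_max.
by move=> _; apply: below_lift; apply: mem_with_max.
Qed.

(** The extra factor is the one at the new point, which lies above all of
    [B]. *)
Lemma num_partitions_embed B :
  num_partitions (embed B) = #|B| * num_partitions B.
Proof.
rewrite !num_partitionsE prod_lift max_notin_embed below_max card_embed.
congr (_ * _); apply: eq_big => x; first by rewrite mem_embed.
by move=> _; apply: below_lift; apply: mem_embed.
Qed.

(** In cycle notation this writes the new point just before [i]: it now maps to
    [i], and what used to map to [i] maps to it.  For [i = ord_max] the new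
    point forms a cycle by itself. *)
Definition insert_max (i : 'I_n.+1) (c : 'S_n) : 'S_n.+1 :=
  (lift_perm ord_max ord_max c * tperm ord_max i)%g.

Lemma insert_max_max i c : insert_max i c ord_max = i.
Proof. by rewrite permM lift_perm_id tpermL. Qed.

Lemma insert_max_lift i c x : insert_max i c (lift ord_max x) =
  if lift ord_max (c x) == i then ord_max else lift ord_max (c x).
Proof.
rewrite permM lift_perm_lift; case: eqP => [->|/eqP ne]; first exact: tpermR.
by rewrite tpermD // eq_sym ?lift_max_neq // eq_sym.
Qed.

(** The image of the new point recovers [i], after which cancelling the
    transposition recovers [c]; equal cardinals [(n+1) n! = (n+1)!] give
    surjectivity. *)
Lemma insert_max_bij : bijective (fun p : 'I_n.+1 * 'S_n => insert_max p.1 p.2).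
Proof.
apply: inj_card_bij => [[i c] [j d] /= eq_ins|]; last first.
  by rewrite card_prod card_ord !card_Sn factS.
have eq_ij : i = j by rewrite -(insert_max_max i c) eq_ins insert_max_max.
move: eq_ins; rewrite -eq_ij => /mulIg eq_cd; congr (_, _).
apply/permP => x; apply: (@lift_inj n.+1 ord_max).
by rewrite -!(lift_perm_lift ord_max) eq_cd.
Qed.

(** Inserting a point into a cycle neither merges nor splits the traces of the
    cycles on the old points. *)
Lemma porbit_insert_max i c (x y : 'I_n) :
  (lift ord_max y \in porbit (insert_max i c) (lift ord_max x)) =
  (y \in porbit c x).
Proof.
apply/idP/idP => [|yx]; last first.
  apply: (@porbit_ind _ c (fun z => lift ord_max z \in
     porbit (insert_max i c) (lift ord_max x)) x _ _ y yx).
    exact: porbit_id.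
  move=> z zx; have := porbit_step zx; rewrite insert_max_lift.
  case: eqP => [->|//] /porbit_step; by rewrite insert_max_max.
(* [r] collapses the new point onto its successor [i], so that each step of
   the new permutation becomes a step of [c] or no step at all.  If
   [i = ord_max] the new point is never reached from [x], and the default [x]
   keeps the invariant meaningful. *)
pose r z := odflt (odflt x (unlift ord_max i)) (unlift ord_max z).
have rl z : r (lift ord_max z) = z by rewrite /r liftK.
have rm : r ord_max = odflt x (unlift ord_max i) by rewrite /r unlift_none.
rewrite -{2}(rl y); apply: (@porbit_ind _ _ (fun z => r z \in porbit c x)).
  by rewrite rl porbit_id.
move=> z; case: (unliftP ord_max z) => [u|] ->.
  rewrite rl insert_max_lift => /porbit_step cu.
  by case: eqP => [eq_i|_]; rewrite ?rl // rm -eq_i liftK.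
by rewrite insert_max_max {2}/r rm; case: (unlift _ _).
Qed.

(** The new point, being the largest, can be a cycle minimum only when it is
    fixed, and it never affects the minimality of an old point. *)
Lemma bl_insert_max i c :
  bl (porbits (insert_max i c)) =
  if i == ord_max then with_max (bl (porbits c)) else embed (bl (porbits c)).
Proof.
apply: setP_max => [|x]; rewrite mem_bl_porbits.
  case: eqP => [->|/eqP ne_i].
    rewrite max_in_with_max; apply/forall_inP => j.
    apply: (@porbit_ind _ (insert_max ord_max c)
      (fun z : 'I_n.+1 => @ord_max n <= z) ord_max) => // z le_z.
    have -> : z = ord_max by apply/val_inj/anti_leq; rewrite le_z -ltnS ltn_ord.
    by rewrite insert_max_max.
  rewrite max_notin_embed; apply/negbTE/forall_inPn; exists i.
    by rewrite -{1}(insert_max_max i c) porbit_step ?porbit_id.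
  by case: (unliftP ord_max i) ne_i => [y|] -> => [_|/eqP//]; rewrite lift_max -ltnNge /=.
rewrite (fun_if (fun S : {set _} => _ \in S)) mem_with_max mem_embed if_same.
rewrite mem_bl_porbits; apply/forall_inP/forall_inP => min_x j.
  by rewrite -(porbit_insert_max i) => /min_x; rewrite !lift_max.
case: (unliftP ord_max j) => [y|] ->; last by rewrite lift_max ltnW.
by rewrite porbit_insert_max !lift_max => /min_x.
Qed.

Lemma num_perms_recr (C : {set 'I_n.+1}) :
  num_perms C = \sum_(i : 'I_n.+1)
    #|[set c : 'S_n | bl (porbits (insert_max i c)) == C]|.
Proof.
rewrite /num_perms -sum1dep_card.
rewrite (reindex (fun p : 'I_n.+1 * 'S_n => insert_max p.1 p.2)); last first.
  exact: onW_bij insert_max_bij.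
rewrite -(pair_big_dep xpredT (fun i c => bl (porbits (insert_max i c)) == C)
  (fun _ _ => 1)) /=.
by apply: eq_bigr => i _; rewrite sum1dep_card.
Qed.

Lemma with_max_inj : injective with_max.
Proof. by move=> B C eqBC; apply/setP=> x; rewrite -!mem_with_max eqBC. Qed.

Lemma embed_inj : injective embed.
Proof. by move=> B C eqBC; apply/setP=> x; rewrite -!mem_embed eqBC. Qed.

Lemma embed_with_max B C : (embed B == with_max C) = false.
Proof.
by apply/eqP => eqBC; have := max_in_with_max C; rewrite -eqBC max_notin_embed.
Qed.

Lemma num_perms_with_max B : num_perms (with_max B) = num_perms B.
Proof.
rewrite num_perms_recr (bigD1 ord_max) //= [X in _ + X]big1 => [|i ne_i].
  rewrite addn0; apply: eq_card => c.
  by rewrite !inE bl_insert_max eqxx (inj_eq with_max_inj).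
by apply: eq_card0 => c; rewrite inE bl_insert_max (negbTE ne_i) embed_with_max.
Qed.

Lemma num_perms_embed B : num_perms (embed B) = n * num_perms B.
Proof.
rewrite num_perms_recr (bigD1 ord_max) //= [X in X + _]eq_card0 => [|c]; last first.
  by rewrite inE bl_insert_max eqxx eq_sym embed_with_max.
rewrite (eq_bigr (fun=> num_perms B)) => [|i ne_i].
  by rewrite sum_nat_const cardC1 card_ord.
apply: eq_card => c.
by rewrite !inE bl_insert_max (negbTE ne_i) (inj_eq embed_inj).
Qed.

End AddLargest.

(** * Recurrences for Stirling and Lah numbers *)

Section Recurrences.

Context (s : nat) (s_gt0 : 0 < s).

Lemma stirling1_recr n k :
  stirling1 s n.+1 k.+1 = stirling1 s n k + n ^ s * stirling1 s n k.+1.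
Proof.
rewrite !stirling1E // (big_set_recr (pred1 k.+1)) big_distrr /=.
by congr (_ + _); apply: eq_bigr => B _;
   rewrite ?num_perms_with_max // num_perms_embed expnMn.
Qed.

(** The factor [n ^ s] makes the statement uniform: it vanishes at [n = 0],
    where the Stirling number is [1], and for [n > 0] the statement says that
    a nonempty set has no partition into zero blocks. *)
Lemma stirling1_0 n : n ^ s * stirling1 s n 0 = 0.
Proof.
elim: n => [|n IHn]; first by rewrite exp0n.
suff -> : stirling1 s n.+1 0 = n ^ s * stirling1 s n 0 by rewrite IHn muln0.
rewrite !stirling1E // (big_set_recr (pred1 0)) big_pred0_eq add0n big_distrr /=.
by apply: eq_bigr => B _; rewrite num_perms_embed expnMn.
Qed.

Lemma stirling1_small n k : n < k -> stirling1 s n k = 0.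
Proof.
move=> lt_nk; rewrite stirling1E // big_pred0 // => B; apply/negbTE.
by rewrite neq_ltn (leq_ltn_trans _ lt_nk) // -[n in _ <= n]card_ord max_card.
Qed.

Lemma stirling2_small n k : n < k -> stirling2 s n k = 0.
Proof.
move=> lt_nk; rewrite stirling2E // big_pred0 // => B; apply/negbTE.
by rewrite neq_ltn (leq_ltn_trans _ lt_nk) // -[n in _ <= n]card_ord max_card.
Qed.

Lemma stirling2_recr n k :
  stirling2 s n.+1 k =
  (if k is k'.+1 then stirling2 s n k' else 0) + k ^ s * stirling2 s n k.
Proof.
rewrite !stirling2E // (big_set_recr (pred1 k)) big_distrr /=; congr (_ + _).
  case: k => [|k]; first by rewrite big_pred0_eq.
  rewrite stirling2E //.
  by apply: eq_bigr => B _; rewrite num_partitions_with_max.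
by apply: eq_bigr => B /eqP <-; rewrite num_partitions_embed expnMn.
Qed.

(** With the lower bound [k] dropped, the range of summation is the same for all
    [k], as the index shift in [lah_recr] requires. *)
Lemma lahE n k :
  lah s n k = \sum_(j < n.+1) stirling1 s n j * stirling2 s j k.
Proof.
rewrite -(big_mkord xpredT (fun j => stirling1 s n j * stirling2 s j k)) /lah.
have [le_kn|lt_nk] := leqP k n.+1.
  rewrite [RHS](big_cat_nat (n := k)) //= [X in _ = X + _]big_nat_cond.
  rewrite [X in _ = X + _]big1 // => j /andP[/andP[_ lt_jk] _].
  by rewrite stirling2_small // muln0.
rewrite (big_geq (ltnW lt_nk)) big_nat_cond big1 // => j /andP[/andP[_ lt_j] _].
by rewrite (stirling2_small (ltn_trans lt_j lt_nk)) muln0.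
Qed.

Lemma lah_small n k : n < k -> lah s n k = 0.
Proof. by move=> lt_nk; rewrite /lah big_geq. Qed.

(** The term [n ^ s] comes from the recurrence of the first kind in [n], the
    terms [lah s n (k-1)] and [k ^ s] from that of the second kind, applied
    after the index shift. *)
Lemma lah_recr n k :
  lah s n.+1 k =
  (if k is k'.+1 then lah s n k' else 0) + (n ^ s + k ^ s) * lah s n k.
Proof.
have first0 : stirling1 s n.+1 0 * stirling2 s 0 k = 0.
  have /eqP := stirling1_0 n.+1.
  by rewrite muln_eq0 expn_eq0 /= => /eqP ->.
(* The shift drops the term [j = 0], killed by [n ^ s], and adds the term
   [j = n + 1], which is zero. *)
have shift : n ^ s * (\sum_(j < n.+1) stirling1 s n j.+1 * stirling2 s j.+1 k)
           = n ^ s * lah s n k.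
  have -> : lah s n k = \sum_(j < n.+2) stirling1 s n j * stirling2 s j k.
    by rewrite lahE [RHS]big_ord_recr /= (stirling1_small (ltnSn n)) addn0.
  by rewrite [in RHS]big_ord_recl mulnDr mulnA stirling1_0.
rewrite lahE big_ord_recl /= first0 add0n.
under eq_bigr => j _ do rewrite stirling1_recr mulnDl -mulnA.
rewrite big_split -big_distrr /= shift mulnDl.
rewrite [X in _ = _ + X]addnC [RHS]addnA; congr (_ + _).
under eq_bigr => j _ do rewrite stirling2_recr mulnDr mulnCA.
rewrite big_split -big_distrr /= -lahE; congr (_ + _).
case: k {first0 shift} => [|k]; last by rewrite lahE.
by rewrite big1 // => j _; rewrite muln0.
Qed.

End Recurrences.

(** * The polynomial recurrence *)

Unset Implicit Arguments.

Local Open Scope ring_scope.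

Lemma coef_lah_poly (s n k : nat) : (lah_poly s n)`_k = (lah s n k)%:R.
Proof.
rewrite /lah_poly -(poly_def _ (fun k => (lah s n k)%:R)) coef_poly.
by case: ltnP => // lt_nk; rewrite lah_small.
Qed.

Lemma coef_lah_B (s n k : nat) : (lah_B s n)`_k = (k ^ s * lah s n k)%N%:R.
Proof.
rewrite /lah_B -(poly_def _ (fun k => (k ^ s * lah s n k)%N%:R)) coef_poly.
by case: ltnP => // lt_nk; rewrite lah_small ?muln0.
Qed.

Theorem theorem3p9 (n s : nat) (hn : (1 <= n)%N) (hs : (1 <= s)%N) :
  lah_poly s n.+1 =
    'X * lah_poly s n + (n ^ s)%N%:R *: lah_poly s n + lah_B s n.
Proof.
apply/polyP => k.
rewrite !coefD coefXM coefZ !coef_lah_poly coef_lah_B lah_recr //.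
rewrite -natrM -addrA -natrD -mulnDl natrD.
by case: k.
Qed.
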